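(* Let $n\ge 4$ and let $\mathbf u$ be a sequence of transpositions in $\mathrm{Sym}(n)$ that has $\langle(0\,1),(1\,2),(0\,2),(0\,3)\rangle$ as a subsequence. Then $\mathbf u$ is not conjugacy invariant.
   Context: $n=\{0,\ldots,n-1\}$; permutations compose left to right. A subsequence is obtained by deleting some terms (not necessarily consecutive). For a finite sequence $\mathbf s$ in $\mathrm{Sym}(n)$, $\bigcirc\mathbf s$ is the composite of its terms in order, $\mathrm{Seq}(\mathbf s)$ its set of rearrangements and $\mathrm{Prod}(\mathbf s)=\{\bigcirc\mathbf r:\mathbf r\in\mathrm{Seq}(\mathbf s)\}$; $\mathbf s$ is conjugacy invariant iff every element of $\mathrm{Prod}(\mathbf s)$ is conjugate to $\bigcirc\mathbf s$. *)

(* Defs.v *)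
From mathcomp Require Import all_boot all_fingroup.

Set Implicit Arguments.
Unset Strict Implicit.
Unset Printing Implicit Defensive.

Local Open Scope group_scope.

(* Permutation products in MathComp compose left to right:
   (s * t) x = t (s x), by permM. *)
Definition seq_comp (n : nat) (s : seq 'S_n) : 'S_n := \prod_(t <- s) t.

Definition Seq_of (n : nat) (s : seq 'S_n) (r : seq 'S_n) : Prop := perm_eq r s.

Definition Prod_of (n : nat) (s : seq 'S_n) (p : 'S_n) : Prop :=
  exists2 r, Seq_of s r & p = seq_comp r.

Definition conjugate (n : nat) (p q : 'S_n) : Prop := exists g : 'S_n, p = q ^ g.

Definition conj_invariant (n : nat) (s : seq 'S_n) : Prop :=
  forall p, Prod_of s p -> conjugate p (seq_comp s).

Definition transposition (n : nat) (p : 'S_n) : Prop :=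
  exists i j : 'I_n, i != j /\ p = tperm i j.

Definition pt (n : nat) (hn : 4 <= n) (k : nat) (hk : k < 4) : 'I_n :=
  Ordinal (leq_trans hk hn).

(* <(0 1), (1 2), (0 2), (0 3)>; the bounds k < 4 hold by computation. *)
Definition triangle_with_tail (n : nat) (hn : 4 <= n) : seq 'S_n :=
  let p0 := @pt n hn 0 isT in
  let p1 := @pt n hn 1 isT in
  let p2 := @pt n hn 2 isT in
  let p3 := @pt n hn 3 isT in
  [:: tperm p0 p1; tperm p1 p2; tperm p0 p2; tperm p0 p3].

(* Main.v *)
Require Import Defs.
From mathcomp Require Import all_boot all_fingroup.
From mathcomp Require Import zify.

Set Implicit Arguments.
Unset Strict Implicit.
Unset Printing Implicit Defensive.

Local Open Scope group_scope.

(** Call weight of a permutation the sum of the squares of its cycle lengths; it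
is a conjugacy invariant, and multiplying by a transposition whose two points
lie in distinct cycles of lengths l and m raises it by 2 l m. The products of
the rearrangements of (0 1), (1 2), (0 2), (0 3) are the nine elements of
A_4 \ C_3, where C_3 = <r> and r = (0 1)(1 2): they are the elements r^i q with q a
double transposition, so this set is stable under multiplication by C_3 on
either side. Let w be the product of the remaining terms. Splitting cycles with
transpositions, w = g z where g permutes {0, 1, 2, 3} and these four points lie
in distinct cycles of z; up to C_3 there are eight possibilities for g. For
g <> 1 the set (A_4 \ C_3) g z contains two elements whose weights obviously
differ, and for g = 1 three of its weights cannot coincide. *)

(** * Cycle weight and its change under a transposition *)

Section OrbitWeight.

Variable T : finType.
Implicit Types (s z w : {perm T}) (x y v : T) (A : {set T}).

(** A cycle of length [l] has [l] points, each contributing [l], so this is the sum of the squared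
    cycle lengths. *)
Definition orbit_weight s : nat := \sum_(v : T) #|porbit s v|.

Lemma porbit_conj s g v : porbit (s ^ g) (g v) = g @: porbit s v.
Proof.
apply/setP=> y; apply/porbitP/imsetP => [[i ->]|[x /porbitP[i ->] ->]].
  exists ((s ^+ i) v); first exact: mem_porbit.
  by rewrite -conjXg permJ.
by exists i; rewrite -conjXg permJ.
Qed.

Lemma orbit_weightJ s g : orbit_weight (s ^ g) = orbit_weight s.
Proof.
rewrite /orbit_weight (reindex_inj (@perm_inj _ g)) /=.
by apply: eq_bigr => v _; rewrite porbit_conj card_imset //; exact: perm_inj.
Qed.

Lemma porbit_subset s A v :
  {in A, forall u, s u \in A} -> v \in A -> porbit s v \subset A.
Proof.
move=> sA Av; apply/subsetP=> y /porbitP[i ->]; elim: i => [|i IHi].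
  by rewrite expg0 perm1.
by rewrite expgSr permM sA.
Qed.

Lemma porbit_step s v u : (s u \in porbit s v) = (u \in porbit s v).
Proof.
by rewrite -!eq_porbit_mem; have := porbit_perm s 1 u; rewrite expg1 => ->.
Qed.

Lemma porbit_tperm_split s x y v :
  y \in porbit s x -> porbit (tperm x y * s) v \subset porbit s v.
Proof.
rewrite -eq_porbit_mem => /eqP exy; apply: porbit_subset (porbit_id _ _) => u.
rewrite permM porbit_step; case: tpermP => // ->.
  by rewrite -!eq_porbit_mem exy.
by rewrite -!eq_porbit_mem exy.
Qed.

(** The number of cycles rises by one if [x] and [y] share a cycle and falls by one otherwise.
    Multiplying by [tperm x y] twice restores [s], so the second change undoes the first. *)
Lemma tperm_split_notin s x y :
  x != y -> x \in porbit s y -> x \notin porbit (tperm x y * s) y.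
Proof.
move=> nxy sxy; have := porbits_mul_tperm s x y.
have := porbits_mul_tperm (tperm x y * s) x y.
by rewrite /= mulgA tperm2 mul1g nxy sxy; case: (x \in _) => //=; lia.
Qed.

Lemma tperm_merge_in s x y :
  x \notin porbit s y -> x \in porbit (tperm x y * s) y.
Proof.
move=> sxy; have nxy: x != y.
  by apply: contraNneq sxy => ->; exact: porbit_id.
have := porbits_mul_tperm s x y.
have := porbits_mul_tperm (tperm x y * s) x y.
by rewrite /= mulgA tperm2 mul1g nxy sxy; case: (x \in _) => //=; lia.
Qed.

Lemma porbit_tperm_merge s x y v : x \notin porbit s y ->
  porbit (tperm x y * s) v =
  if v \in porbit s x :|: porbit s y then porbit s x :|: porbit s y
  else porbit s v.
Proof.
move=> sxy; set U := _ :|: _; set t := tperm x y * s.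
have txy := tperm_merge_in sxy.
(* [s] arises from [t] by a split, so its cycles lie inside those of [t]. *)
have refine u : porbit s u \subset porbit t u.
  have := @porbit_tperm_split t x y u.
  by rewrite /t mulgA tperm2 mul1g; apply; rewrite porbit_sym.
have stepU u : (s (tperm x y u) \in U) = (u \in U).
  rewrite !inE !porbit_step; case: tpermP => // ->;
  by rewrite !porbit_id ?orbT.
case: ifP => [Uv | nUv]; apply/eqP; rewrite eqEsubset.
  apply/andP; split; first by apply: porbit_subset => // u; rewrite permM stepU.
  have/eqP exy: porbit t x == porbit t y by rewrite eq_porbit_mem.
  have -> : porbit t v = porbit t x.
    apply/eqP; rewrite eq_porbit_mem.
    case/setUP: Uv => /(subsetP (refine _)) //.
    by rewrite -exy.
  by rewrite subUset refine exy refine.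
rewrite refine andbT; apply/subsetP => u tu.
have: (u \in porbit s v) && (u \notin U).
  (* The transposition moves only points of [U], so [t] keeps [porbit s v :\: U] stable. *)
  move: u tu; have sub: porbit t v \subset porbit s v :\: U.
    apply: porbit_subset => [u|]; last by rewrite inE nUv porbit_id.
    rewrite inE => /andP[nU su]; rewrite inE permM stepU nU porbit_step /=.
    by case: tpermP su nU => // ->; rewrite !inE porbit_id ?orbT.
  by move=> u /(subsetP sub); rewrite inE andbC.
by case/andP.
Qed.

Lemma card_porbit_merge s x y : x \notin porbit s y ->
  #|porbit s x :|: porbit s y| = (#|porbit s x| + #|porbit s y|)%N.
Proof.
move=> sxy; rewrite cardsU (_ : _ :&: _ = set0) ?cards0 ?subn0 //.
apply/setP=> v; rewrite !inE; apply/andP=> [[]].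
rewrite -!eq_porbit_mem => /eqP -> e; move: sxy.
by rewrite -eq_porbit_mem e.
Qed.

(** Only points of the two merged cycles contribute differently: for lengths l and m, (l + m)^2
    replaces l^2 + m^2. *)
Lemma orbit_weight_merge s x y : x \notin porbit s y ->
  orbit_weight (tperm x y * s) =
  (orbit_weight s + 2 * (#|porbit s x| * #|porbit s y|))%N.
Proof.
move=> sxy; rewrite /orbit_weight.
set U := porbit s x :|: porbit s y.
have cU : #|U| = (#|porbit s x| + #|porbit s y|)%N := card_porbit_merge sxy.
rewrite (bigID (mem U)) [X in _ = X + _](bigID (mem U)) /=.
have -> : \sum_(v in U) #|porbit (tperm x y * s) v| = (#|U| * #|U|)%N.
  rewrite -sum_nat_const; apply: eq_bigr => v Uv.
  by rewrite porbit_tperm_merge // Uv.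
have -> : \sum_(v | v \notin U) #|porbit (tperm x y * s) v| =
          \sum_(v | v \notin U) #|porbit s v|.
  by apply: eq_bigr => v /negbTE nU; rewrite porbit_tperm_merge // nU.
have -> : \sum_(v in U) #|porbit s v| =
   (#|porbit s x| * #|porbit s x| + #|porbit s y| * #|porbit s y|)%N.
  rewrite -!sum_nat_const (bigID (mem (porbit s x))) /=; congr addn.
    apply: eq_big => [v|v /andP[_]].
      by rewrite inE; case: (v \in porbit s x); rewrite ?andbF.
    by rewrite -eq_porbit_mem => /eqP ->.
  apply: eq_big => [v|v /andP[Uv nv]].
    rewrite inE; case: (boolP (v \in porbit s x)) => //=; rewrite ?andbT //.
    rewrite -!eq_porbit_mem => /eqP ->; apply/esym/negbTE.
    by rewrite eq_porbit_mem.
  case/setUP: Uv nv => [-> //|]; rewrite -eq_porbit_mem => /eqP -> //.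
by rewrite cU; lia.
Qed.

(** * Successive merging of separated cycles *)

Definition separates s (X : seq T) : bool :=
  pairwise (fun x y => x \notin porbit s y) X.

Lemma separatesP s X x y :
  separates s X -> x \in X -> y \in X -> x != y -> x \notin porbit s y.
Proof.
elim: X => //= z X IHX /andP[/allP zX sX]; rewrite !inE.
case/predU1P=> [->|Xx] /predU1P[->|Xy] nxy; last exact: IHX.
- by rewrite eqxx in nxy.
- exact: zX.
by rewrite porbit_sym; exact: zX.
Qed.

Lemma orbit_weight_tperm2 s x y u v : separates s [:: x; y; u; v] ->
  orbit_weight (tperm x y * (tperm u v * s)) =
  (orbit_weight s + 2 * (#|porbit s x| * #|porbit s y|)
    + 2 * (#|porbit s u| * #|porbit s v|))%N.
Proof.
rewrite /separates /= !andbT -!andbA.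
case/and5P=> xy xu xv yu /andP[yv uv].
rewrite !orbit_weight_merge ?porbit_tperm_merge //;
  rewrite ?inE ?(negbTE xy, negbTE xu, negbTE xv, negbTE yu, negbTE yv) //=.
lia.
Qed.

(** Merges are counted from the right: the cycles of [x] and [u] are joined, then the result is
    joined with that of [y]. *)
Lemma orbit_weight_cycle3 s x y u : separates s [:: x; y; u] ->
  orbit_weight (tperm x y * (tperm x u * s)) =
  (orbit_weight s + 2 * (#|porbit s x| * #|porbit s u|)
    + 2 * ((#|porbit s x| + #|porbit s u|) * #|porbit s y|))%N.
Proof.
rewrite /separates /= !andbT -!andbA.
case/and3P=> xy xu yu.
have yx : y \notin porbit s x by rewrite porbit_sym.
rewrite !orbit_weight_merge ?porbit_tperm_merge //;
  by rewrite ?inE ?porbit_id ?(negbTE yx, negbTE yu) //= ?card_porbit_merge.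
Qed.

Lemma orbit_weight_cycle4 s x y u v : separates s [:: x; y; u; v] ->
  orbit_weight (tperm x y * (tperm x u * (tperm x v * s))) =
  (orbit_weight s + 2 * (#|porbit s x| * #|porbit s v|)
    + 2 * ((#|porbit s x| + #|porbit s v|) * #|porbit s u|)
    + 2 * ((#|porbit s x| + #|porbit s u| + #|porbit s v|) * #|porbit s y|))%N.
Proof.
rewrite /separates /= !andbT -!andbA.
case/and5P=> xy xu xv yu /andP[yv uv].
have yx : y \notin porbit s x by rewrite porbit_sym.
have ux : u \notin porbit s x by rewrite porbit_sym.
have merged p := porbit_tperm_merge p xv.
rewrite orbit_weight_cycle3; last first.
  rewrite /separates /= !(porbit_sym _ x) !merged !inE porbit_id /=.
  rewrite (negbTE ux) (negbTE uv) !inE (negbTE yx) (negbTE yv) yu.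
  by rewrite (negbTE ux) (negbTE uv).
rewrite orbit_weight_merge // !merged !inE porbit_id /=.
rewrite (negbTE ux) (negbTE uv) (negbTE yx) (negbTE yv) /= card_porbit_merge //.
lia.
Qed.

End OrbitWeight.

(** * The group C_3 and the double transpositions on four points *)

Section FourPoints.

Variables (T : finType) (x0 x1 x2 x3 : T).
Hypothesis uniqX : uniq [:: x0; x1; x2; x3].
Implicit Types (s z w : {perm T}).

Local Notation rho := (tperm x0 x1 * tperm x1 x2).
(** Only the nonidentity elements of the Klein four-group, so that the products [rho ^+ i * q]
    exhaust A_4 \ C_3. *)
Local Notation V4 := [:: tperm x0 x3 * tperm x1 x2;
                         tperm x1 x3 * tperm x0 x2; tperm x2 x3 * tperm x0 x1].
Local Notation X := [:: x0; x1; x2; x3].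

Lemma neqX : [/\ x0 != x1, x0 != x2, x0 != x3, x1 != x2 & x1 != x3 /\ x2 != x3].
Proof. by case/and4P: uniqX; rewrite !inE !negb_or => /and3P[] ? ? ? /andP[]. Qed.

Lemma eq_perm4 s w :
    (forall v, v \notin X -> s v = w v) ->
  [/\ s x0 = w x0, s x1 = w x1, s x2 = w x2 & s x3 = w x3] -> s = w.
Proof.
move=> e [e0 e1 e2 e3]; apply/permP=> v.
have [|] := boolP (v \in X); last exact: e.
by rewrite !inE => /or4P[] /eqP ->.
Qed.

Lemma tperm_notin v i j : v \notin X -> i \in X -> j \in X -> tperm i j v = v.
Proof.
by move=> nv Xi Xj; apply: tpermD; apply: contraNneq nv => <-.
Qed.

Lemma tpermX :
  ((tperm x0 x1 x2 = x2) * (tperm x0 x1 x3 = x3) * (tperm x0 x2 x1 = x1) *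
   (tperm x0 x2 x3 = x3) * (tperm x0 x3 x1 = x1) * (tperm x0 x3 x2 = x2) *
   (tperm x1 x2 x0 = x0) * (tperm x1 x2 x3 = x3) * (tperm x1 x3 x0 = x0) *
   (tperm x1 x3 x2 = x2) * (tperm x2 x3 x0 = x0) * (tperm x2 x3 x1 = x1))%type.
Proof.
have [n01 n02 n03 n12 [n13 n23]] := neqX.
by do !split; apply: tpermD; rewrite // eq_sym.
Qed.

(** Proves identities between products of transpositions of the four points: both sides fix all
    other points and are evaluated at these four. *)
Ltac perm4 :=
  rewrite ?expgS ?expg0 ?mulg1;
  apply: eq_perm4;
  [ let v := fresh "v" in let nv := fresh "nv" in intros v nv;
    rewrite !(permM, perm1);
    repeat (rewrite [tperm _ _ v](tperm_notin nv);
            [ | by rewrite !inE eqxx ?orbT ..]);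
    by []
  | by split; rewrite !(permM, perm1, tpermL, tpermR, tpermX) ].

Lemma rho3 : rho ^+ 3 = 1.
Proof. perm4. Qed.

Lemma V4J q : q \in V4 -> q ^ rho \in V4.
Proof.
have e0 : (tperm x0 x3 * tperm x1 x2) * rho = rho * (tperm x2 x3 * tperm x0 x1).
  perm4.
have e1 : (tperm x1 x3 * tperm x0 x2) * rho = rho * (tperm x0 x3 * tperm x1 x2).
  perm4.
have e2 : (tperm x2 x3 * tperm x0 x1) * rho = rho * (tperm x1 x3 * tperm x0 x2).
  perm4.
by rewrite !inE => /or3P[] /eqP ->;
   rewrite conjgE ?e0 ?e1 ?e2 mulKg ?eqxx /= ?orbT.
Qed.

Lemma V4_rearrangements w K :
    (forall r, perm_eq r [:: tperm x0 x1; tperm x1 x2; tperm x0 x2; tperm x0 x3] ->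
       orbit_weight (\prod_(t <- r) t * w) = K) ->
  forall i q, q \in V4 -> orbit_weight (rho ^+ i * q * w) = K.
Proof.
move=> HK i q Vq.
set a := tperm x0 x1 in HK; set b := tperm x1 x2 in HK.
set c := tperm x0 x2 in HK; set d := tperm x0 x3 in HK.
have HpK r p : perm_eq r [:: a; b; c; d] -> p = \prod_(t <- r) t ->
  orbit_weight (p * w) = K by move=> /HK <- ->.
have -> : rho ^+ i = rho ^+ (i %% 3).
  by rewrite {1}(divn_eq i 3) expgD mulnC expgM rho3 expg1n mul1g.
have: i %% 3 < 3 by rewrite ltn_mod.
move: Vq; rewrite !inE.
case: (i %% 3) => [|[|[|//]]] /or3P[] /eqP-> _.
(* One rearrangement for each choice of [i] modulo 3 and [q]: three for each residue, in the order
   of [V4]. *)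
all: [> apply: (HpK [:: a; b; c; d]) | apply: (HpK [:: b; c; d; a])
      | apply: (HpK [:: b; a; d; c]) | apply: (HpK [:: b; a; c; d])
      | apply: (HpK [:: c; b; d; a]) | apply: (HpK [:: d; b; c; a])
      | apply: (HpK [:: a; c; b; d]) | apply: (HpK [:: d; c; a; b])
      | apply: (HpK [:: a; b; d; c])].
all: try by apply/seq.permP=> P /=; lia.
all: rewrite !big_cons big_nil mulg1 /a /b /c /d; perm4.
Qed.

Lemma V4_rho_shift j w K :
    (forall i q, q \in V4 -> orbit_weight (rho ^+ i * q * (rho ^+ j * w)) = K) ->
  forall i q, q \in V4 -> orbit_weight (rho ^+ i * q * w) = K.
Proof.
move=> HK i q Vq.
have VJ k : q ^ (rho ^+ k) \in V4.
  elim: k => [|k IHk]; first by rewrite expg0 conjg1.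
  by rewrite expgSr conjgM V4J.
(* Conjugating [q] by [rho ^+ (j * 2)], the inverse of [rho ^+ j], cancels [rho ^+ j] on the right;
   the exponent [i + j * 2] compensates on the left. *)
rewrite -(HK (i + j * 2)%N _ (VJ (j * 2)%N)); congr orbit_weight.
have r3 : rho ^+ (j * 2)%N * rho ^+ j = 1.
  by rewrite -expgD (_ : (j * 2 + j = 3 * j)%N) ?expgM ?rho3 ?expg1n //; lia.
by rewrite expgD conjgE !mulgA mulgK -(mulgA (_ * q)) r3 mulg1.
Qed.

(** * Splitting cycles until the four points are separated *)

Lemma separation012 w : exists j t v,
  [/\ t \in [:: 1; tperm x0 x1], separates v [:: x0; x1; x2]
    & w = rho ^+ j * t * v].
Proof.
have [n01 n02 _ n12 _] := neqX.
have refine s p q x y :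
    p \in porbit s q -> x \notin porbit s y -> x \notin porbit (tperm p q * s) y.
  rewrite porbit_sym => spq; apply: contraNN; apply: subsetP.
  exact: porbit_tperm_split.
have sep3 s : separates s [:: x0; x1; x2] =
   [&& x0 \notin porbit s x1, x0 \notin porbit s x2 & x1 \notin porbit s x2].
  by rewrite /separates /= !andbT -andbA.
have undo p q s : s = tperm p q * (tperm p q * s) by rewrite mulgA tperm2 mul1g.
have trans s p q u : p \in porbit s q -> p \notin porbit s u -> q \notin porbit s u.
  by rewrite -!eq_porbit_mem => /eqP ->.
(* The transpositions split off multiply to an element of the symmetric group on [x0], [x1], [x2],
   where 1 and [tperm x0 x1] represent the cosets of C_3. *)
have c_rho : tperm x0 x2 = rho ^+ 1 * tperm x0 x1 by perm4.
have b_rho : tperm x1 x2 = rho ^+ 2 * tperm x0 x1 by perm4.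
have ac_rho : tperm x0 x1 * tperm x0 x2 = rho ^+ 2 * 1 by perm4.
have ab_rho : tperm x0 x1 * tperm x1 x2 = rho ^+ 1 * 1 by rewrite expg1 mulg1.
have [w01|w01] := boolP (x0 \in porbit w x1); last first.
  have [w02|w02] := boolP (x0 \in porbit w x2).
    exists 1%N, (tperm x0 x1), (tperm x0 x2 * w).
    rewrite !inE eqxx orbT -c_rho -undo sep3; split=> //.
    rewrite tperm_split_notin // !refine //.
    by rewrite porbit_sym; exact: trans w02 w01.
  have [w12|w12] := boolP (x1 \in porbit w x2).
    exists 2, (tperm x0 x1), (tperm x1 x2 * w).
    rewrite !inE eqxx orbT -b_rho -undo sep3; split=> //.
    by rewrite tperm_split_notin // !refine.
  exists 0%N, 1, w; rewrite !inE eqxx sep3 w01 w02 w12.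
  by split; rewrite // expg0 !mul1g.
(* With [x0] and [x1] split, at most one of them shares a cycle with [x2], so one more split
   suffices. *)
set w1 := tperm x0 x1 * w.
have w1_01 : x0 \notin porbit w1 x1 by exact: tperm_split_notin.
have -> : w = tperm x0 x1 * w1 by exact: undo.
move: w1 w1_01 => w1 w1_01.
have [w1_02|w1_02] := boolP (x0 \in porbit w1 x2).
  exists 2, 1, (tperm x0 x2 * w1).
  rewrite !inE eqxx -ac_rho -mulgA -undo sep3; split=> //.
  rewrite tperm_split_notin // !refine //.
  by rewrite porbit_sym; exact: trans w1_02 w1_01.
have [w1_12|w1_12] := boolP (x1 \in porbit w1 x2).
  exists 1%N, 1, (tperm x1 x2 * w1).
  rewrite !inE eqxx -ab_rho -mulgA -undo sep3; split=> //.
  by rewrite tperm_split_notin // !refine.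
exists 0%N, (tperm x0 x1), w1; rewrite !inE eqxx orbT expg0 mul1g sep3.
by rewrite w1_01 w1_02 w1_12.
Qed.

(** Once [x0], [x1], [x2] are separated, at most one of them shares a cycle with [x3], and a single
    split separates these two. *)
Lemma separation w : exists j t u z,
  [/\ t \in [:: 1; tperm x0 x1],
      u \in [:: 1; tperm x0 x3; tperm x1 x3; tperm x2 x3],
      separates z X & w = rho ^+ j * (t * (u * z))].
Proof.
have [n01 n02 n03 n12 [n13 n23]] := neqX.
have [j [t [v [tin sv ->]]]] := separation012 w; exists j, t.
have undo p q s : s = tperm p q * (tperm p q * s) by rewrite mulgA tperm2 mul1g.
move: sv; rewrite /separates /= !andbT -!andbA => /and3P[v01 v02 v12].
have trans s p q u : p \in porbit s q -> p \notin porbit s u -> u \notin porbit s q.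
  by rewrite -!eq_porbit_mem => /eqP ->; rewrite eq_sym.
have refine p q x y :
    p \in porbit v q -> x \notin porbit v y -> x \notin porbit (tperm p q * v) y.
  rewrite porbit_sym => vpq; apply: contraNN; apply: subsetP.
  exact: porbit_tperm_split.
(* Splitting refines the cycles, so only the pairs involving [x3] need checking. *)
have sepX p q : p \in porbit v q ->
    [&& x0 \notin porbit (tperm p q * v) x3, x1 \notin porbit (tperm p q * v) x3
      & x2 \notin porbit (tperm p q * v) x3] ->
    separates (tperm p q * v) X.
  by move=> vpq /and3P[a03 a13 a23]; rewrite /separates /= a03 a13 a23 !refine.
have [v03|v03] := boolP (x0 \in porbit v x3).
  exists (tperm x0 x3), (tperm x0 x3 * v); rewrite -undo mulgA; split=> //.
    by rewrite !inE eqxx orbT.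
  apply: sepX => //; rewrite tperm_split_notin // !refine //;
    exact: trans v03 _.
have [v13|v13] := boolP (x1 \in porbit v x3).
  exists (tperm x1 x3), (tperm x1 x3 * v); rewrite -undo mulgA; split=> //.
    by rewrite !inE eqxx !orbT.
  apply: sepX => //; rewrite tperm_split_notin // !refine //.
  exact: trans v13 _.
have [v23|v23] := boolP (x2 \in porbit v x3).
  exists (tperm x2 x3), (tperm x2 x3 * v); rewrite -undo mulgA; split=> //.
    by rewrite !inE eqxx !orbT.
  by apply: sepX => //; rewrite tperm_split_notin // !refine.
exists 1, v; rewrite mul1g mulgA; split=> //; first exact: mem_head.
by rewrite /separates /= v01 v02 v03 v12 v13 v23.
Qed.

(** * Comparison of weights in the eight cases *)

Lemma cycle3_weights_incompatible (l0 l1 l2 l3 m : nat) : 0 < l1 -> 0 < l3 ->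
  (m + 2 * (l1 * l3) + 2 * ((l1 + l3) * l2) = m + 2 * (l0 * l1) + 2 * (l2 * l3) ->
   m + 2 * (l0 * l3) + 2 * ((l0 + l3) * l1) = m + 2 * (l0 * l1) + 2 * (l2 * l3) ->
   False)%N.
Proof.
move=> l1_gt0 l3_gt0 e2 e1.
(* Cancelling [l3] and [l1] leaves l0 + l1 = l2 and l3 + l2 = l0, so l1 + l3 = 0. *)
have: (l3 * (l0 + l1) == l3 * l2)%N by apply/eqP; lia.
have: (l1 * (l3 + l2) == l1 * l0)%N by apply/eqP; lia.
by rewrite !eqn_pmul2l // => /eqP ? /eqP ?; lia.
Qed.

Lemma V4_weight_nonconstant t u z K :
    t \in [:: 1; tperm x0 x1] ->
    u \in [:: 1; tperm x0 x3; tperm x1 x3; tperm x2 x3] ->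
    separates z X ->
  ~ (forall i q, q \in V4 -> orbit_weight (rho ^+ i * q * (t * (u * z))) = K).
Proof.
move=> tin uin sz HK.
have [n01 n02 n03 n12 [n13 n23]] := neqX.
have pos v : 0 < #|porbit z v| by rewrite lt0n card_porbit_neq0.
have pos2 v v' : (0 < #|porbit z v| * #|porbit z v'|)%N by rewrite muln_gt0 !pos.
(* Products of lengths are atoms for [lia], so their positivity is supplied. *)
have [l01 l02 l12] := And3 (pos2 x0 x1) (pos2 x0 x2) (pos2 x1 x2).
have q0V : tperm x0 x3 * tperm x1 x2 \in V4 by rewrite !inE eqxx.
have q1V : tperm x1 x3 * tperm x0 x2 \in V4 by rewrite !inE eqxx orbT.
have q2V : tperm x2 x3 * tperm x0 x1 \in V4 by rewrite !inE eqxx !orbT.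
have val i q p : q \in V4 -> rho ^+ i * q * (t * u) = p -> orbit_weight (p * z) = K.
  by move=> Vq <-; rewrite -(HK i q Vq) !mulgA.
have distinct p q : p \in X -> q \in X -> p != q -> p \notin porbit z q.
  exact: separatesP.
have val2 i q p r : q \in V4 -> rho ^+ i * q * (t * u) = p * r ->
    orbit_weight (p * (r * z)) = K by move=> Vq /(val _ _ _ Vq); rewrite mulgA.
have val3 i q p r s : q \in V4 -> rho ^+ i * q * (t * u) = p * (r * s) ->
    orbit_weight (p * (r * (s * z))) = K.
  by move=> Vq /(val _ _ _ Vq); rewrite !mulgA.
have [n20 n30 n21 n31] : [/\ x2 != x0, x3 != x0, x2 != x1 & x3 != x1].
  by split; rewrite eq_sym.
have n32 : x3 != x2 by rewrite eq_sym.
have inX : [/\ x0 \in X, x1 \in X, x2 \in X & x3 \in X].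
  by rewrite !inE !eqxx !orbT.
have {inX} [X0 X1 X2 X3] := inX.
have sep3 p q r : p != q -> p != r -> q != r -> p \in X -> q \in X -> r \in X ->
  separates z [:: p; q; r] by move=> *; rewrite /separates /= !distinct.
have sep4 p q r (s : T) : p != q -> p != r -> p != s -> q != r -> q != s -> r != s ->
    p \in X -> q \in X -> r \in X -> s \in X ->
  separates z [:: p; q; r; s] by move=> *; rewrite /separates /= !distinct.
move: tin uin; rewrite !inE.
case/orP=> /eqP et /or4P[] /eqP eu;
  rewrite {}et {}eu ?mul1g ?mulg1 in val val2 val3.
(* Case g = 1: two 3-cycles and a double transposition. *)
- have := val2 1%N _ (tperm x0 x1) (tperm x0 x3) q0V ltac:(perm4).
  have := val2 1%N _ (tperm x1 x2) (tperm x1 x3) q1V ltac:(perm4).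
  have := val2 0%N _ (tperm x0 x1) (tperm x2 x3) q2V ltac:(perm4).
  rewrite orbit_weight_tperm2 ?orbit_weight_cycle3 ?sep3 //.
  by move=> <-; exact: cycle3_weights_incompatible.
(* Here and in the next three cases g is odd: a 4-cycle, merging all four cycles, outweighs a
   transposition merging two of them. *)
- have := val3 0%N _ (tperm x0 x2) (tperm x0 x3) (tperm x0 x1) q1V ltac:(perm4).
  have := val 0%N _ (tperm x1 x2) q0V ltac:(perm4).
  rewrite orbit_weight_cycle4 ?orbit_weight_merge ?sep4 ?distinct //;
    move: l01 l02 l12; clear; lia.
- have := val3 0%N _ (tperm x0 x1) (tperm x0 x2) (tperm x0 x3) q0V ltac:(perm4).
  have := val 0%N _ (tperm x0 x2) q1V ltac:(perm4).
  rewrite orbit_weight_cycle4 ?orbit_weight_merge ?sep4 ?distinct //;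
    move: l01 l02 l12; clear; lia.
- have := val3 0%N _ (tperm x0 x2) (tperm x0 x1) (tperm x0 x3) q0V ltac:(perm4).
  have := val 0%N _ (tperm x0 x1) q2V ltac:(perm4).
  rewrite orbit_weight_cycle4 ?orbit_weight_merge ?sep4 ?distinct //;
    move: l01 l02 l12; clear; lia.
- have := val3 0%N _ (tperm x0 x2) (tperm x0 x1) (tperm x0 x3) q1V ltac:(perm4).
  have := val 0%N _ (tperm x2 x3) q2V ltac:(perm4).
  rewrite orbit_weight_cycle4 ?orbit_weight_merge ?sep4 ?distinct //;
    move: l01 l02 l12; clear; lia.
(* Here and in the next case g is a 3-cycle moving [x3]; its inverse lies in A_4 \ C_3, so 1 occurs,
   along with a 3-cycle. *)
- have := val 2%N _ 1 q1V ltac:(perm4); rewrite mul1g.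
  have := val2 0%N _ (tperm x0 x3) (tperm x0 x2) q2V ltac:(perm4).
  rewrite orbit_weight_cycle3 ?sep3 //; move: l01 l02 l12; clear; lia.
- have := val 1%N _ 1 q0V ltac:(perm4); rewrite mul1g.
  have := val2 0%N _ (tperm x1 x3) (tperm x1 x2) q2V ltac:(perm4).
  rewrite orbit_weight_cycle3 ?sep3 //; move: l01 l02 l12; clear; lia.
(* Now g is a double transposition, its own inverse: 1 occurs, along with another double
   transposition. *)
have := val 0%N _ 1 q2V ltac:(perm4); rewrite mul1g.
have := val2 0%N _ (tperm x0 x3) (tperm x1 x2) q1V ltac:(perm4).
rewrite orbit_weight_tperm2 ?sep4 //; move: l01 l02 l12; clear; lia.
Qed.

End FourPoints.

(** * Rearrangements of a conjugacy invariant sequence *)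

Theorem theorem3p14 (n : nat) (hn : 4 <= n) (u : seq 'S_n)
    (hu : forall t, t \in u -> transposition t)
    (hsub : subseq (triangle_with_tail hn) u) :
  ~ conj_invariant u.
Proof.
(* Up to rearrangement, the remaining terms [v] follow the four given transpositions. *)
move=> inv; have [v uTv] := perm_to_subseq hsub.
pose x k (hk : k < 4) : 'I_n := pt hn hk.
have uniqX : uniq [:: x 0 isT; x 1%N isT; x 2 isT; x 3 isT] by [].
have prodK r : perm_eq r (triangle_with_tail hn) ->
    orbit_weight (\prod_(t <- r) t * seq_comp v) = orbit_weight (seq_comp u).
  move=> rT; rewrite /seq_comp -big_cat.
  have [|g ->] := inv (\prod_(t <- r ++ v) t); last exact: orbit_weightJ.
  exists (r ++ v) => //; rewrite /Seq_of perm_sym (permPl uTv).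
  by rewrite perm_cat2r perm_sym.
have V4K := V4_rearrangements uniqX prodK.
have [j [t [y [z [tin yin sz e]]]]] := separation uniqX (seq_comp v).
rewrite {}e in V4K.
exact: (V4_weight_nonconstant uniqX tin yin sz (V4_rho_shift uniqX V4K)).
Qed.
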